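(* Let $X$ be a topological space. The map $\iota \colon \mathcal P_{\mathsf V} X \to \mathcal P^{\mathrm{quasi}}_{\mathsf V} X$, $\iota(L) = (\uparrow L, cl(L))$, is a topological embedding of the space of lenses into the space of quasi-lenses. For every open subset $U$ of $X$, $\iota^{-1}(\Box^{\mathrm{quasi}} U) = \Box U$ and $\iota^{-1}(\Diamond^{\mathrm{quasi}} U) = \Diamond U$. Moreover, suppose that $X$ satisfies the following property: (P) for every compact saturated subset $Q$ of $X$ and every closed subset $C$ of $X$, if $C \subseteq cl(U \cap C)$ for every open neighborhood $U$ of $Q$, then $C \subseteq cl(Q \cap C)$. Then $\iota$ is a homeomorphism of $\mathcal P_{\mathsf V} X$ onto $\mathcal P^{\mathrm{quasi}}_{\mathsf V} X$, with inverse $\varrho \colon (Q, C) \mapsto Q \cap C$. This applies in particular if $X$ is weakly Hausdorff.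
   Context: Compact means every open cover has a finite subcover (no separation). The specialization preordering of $X$ is $x \leq y$ iff every open neighborhood of $x$ contains $y$; $\uparrow A$ denotes the upward closure of $A$ in $\leq$, and $\uparrow x = \uparrow\{x\}$; $cl(A)$ is the topological closure. A set is saturated iff it is upwards-closed in $\leq$ (equivalently, an intersection of open sets). $X$ is weakly Hausdorff iff for all $x, y \in X$, every open set $W$ containing $\uparrow x \cap \uparrow y$ contains an intersection $U \cap V$ of an open neighborhood $U$ of $x$ and an open neighborhood $V$ of $y$. A lens of $X$ is a non-empty set of the form $Q \cap C$ with $Q$ compact saturated and $C$ closed. $\mathcal P_{\mathsf V} X$ is the space of all lenses, with the Vietoris topology, which has subbasic open sets $\Box U = \{L \mid L \subseteq U\}$ and $\Diamond U = \{L \mid L \cap U \neq \emptyset\}$, $U$ open in $X$. A quasi-lens of $X$ is a pair $(Q, C)$ with $Q$ compact saturated and $C$ closed, such that: (1) $Q \cap C \neq \emptyset$; (2) $Q \subseteq \uparrow(Q \cap C)$; (3) for every open neighborhood $U$ of $Q$, $C \subseteq cl(U \cap C)$. $\mathcal P^{\mathrm{quasi}}_{\mathsf V} X$ is the space of all quasi-lenses, with the topology having subbasic open sets $\Box^{\mathrm{quasi}} U = \{(Q, C) \mid Q \subseteq U\}$ and $\Diamond^{\mathrm{quasi}} U = \{(Q, C) \mid C \cap U \neq \emptyset\}$, $U$ open in $X$. *)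

(* Defs.v *)
From HB Require Import structures.
From mathcomp Require Import all_boot.
From mathcomp Require Import all_classical.
From mathcomp Require Import topology.

Set Implicit Arguments.
Unset Strict Implicit.
Unset Printing Implicit Defensive.

Local Open Scope classical_set_scope.

Section Specialization.
Context {X : topologicalType}.
Implicit Types (x y : X) (A Q C U V W : set X).

Definition spec_le x y := forall U, open_nbhs x U -> U y.

Definition upset A : set X := [set y | exists2 x, A x & spec_le x y].

Definition saturated A := forall x y, A x -> spec_le x y -> A y.

(* [cover_compact] is the plain open-cover property, without separation. *)
Definition compact_saturated Q := cover_compact Q /\ saturated Q.

Definition is_lens (L : set X) :=
  L !=set0 /\
  exists Q C, [/\ compact_saturated Q, closed C & L = Q `&` C].

Definition is_quasi_lens Q C :=
  [/\ compact_saturated Q, closed C, Q `&` C !=set0,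
      Q `<=` upset (Q `&` C)
    & forall U, open U -> Q `<=` U -> C `<=` closure (U `&` C)].

End Specialization.

Definition weakly_hausdorff (X : topologicalType) :=
  forall (x y : X) (W : set X), open W ->
    upset [set x] `&` upset [set y] `<=` W ->
    exists U V : set X,
      [/\ open_nbhs x U, open_nbhs y V & U `&` V `<=` W].

Definition propertyP (X : topologicalType) :=
  forall Q C : set X, compact_saturated Q -> closed C ->
    (forall U : set X, open U -> Q `<=` U -> C `<=` closure (U `&` C)) ->
    C `<=` closure (Q `&` C).

Record lens (X : topologicalType) := Lens {
  lens_set :> set X;
  lensP : is_lens lens_set }.

Record quasi_lens (X : topologicalType) := QuasiLens {
  ql_compact : set X;
  ql_closed : set X;
  quasi_lensP : is_quasi_lens ql_compact ql_closed }.

Definition box {X : topologicalType} (U : set X) : set (lens X) :=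
  [set L : lens X | L `<=` U].

Definition diamond {X : topologicalType} (U : set X) : set (lens X) :=
  [set L : lens X | L `&` U !=set0].

Definition qbox {X : topologicalType} (U : set X) : set (quasi_lens X) :=
  [set q | ql_compact q `<=` U].

Definition qdiamond {X : topologicalType} (U : set X) : set (quasi_lens X) :=
  [set q | ql_closed q `&` U !=set0].

HB.instance Definition _ X := gen_eqMixin (lens X).
HB.instance Definition _ X := gen_choiceMixin (lens X).
HB.instance Definition _ X := gen_eqMixin (quasi_lens X).
HB.instance Definition _ X := gen_choiceMixin (quasi_lens X).

(* In [isSubBaseTopological.Build T D b], the subbase is the family of the
   [b i] for [i] in [D]; here it is indexed by itself. *)
HB.instance Definition _ (X : topologicalType) :=
  isSubBaseTopological.Build (lens X)
    ([set box U | U in open] `|` [set diamond U | U in open]) id.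

HB.instance Definition _ (X : topologicalType) :=
  isSubBaseTopological.Build (quasi_lens X)
    ([set qbox U | U in open] `|` [set qdiamond U | U in open]) id.

(* Homeomorphism onto the image, the image carrying the subspace topology. *)
Definition embedding (S T : topologicalType) (f : S -> T) :=
  [/\ injective f, continuous f
    & forall U : set S, open U ->
        exists2 V : set T, open V & f @` U = V `&` range f].

Definition homeomorphism_with_inverse (S T : topologicalType)
    (f : S -> T) (g : T -> S) :=
  [/\ cancel f g, cancel g f, continuous f & continuous g].

(* Main.v *)
Require Import Defs.
From mathcomp Require Import all_boot.
From mathcomp Require Import finmap.
From mathcomp Require Import all_classical.
From mathcomp Require Import topology.

Local Open Scope classical_set_scope.

(** A lens is recovered from its image as L = upset L `&` closure L, whence
    injectivity. Every subbasic open set of lenses is the preimage of the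
    corresponding subbasic open set of quasi-lenses, and preimages commute with
    unions and intersections: the topology of lenses is thus the one induced by
    iota. Under (P), every quasi-lens (Q, C) is the image of Q `&` C.
    If X is weakly Hausdorff and x in C had an open neighborhood W disjoint from
    Q `&` C, then for each y in Q the set ~` C would contain upset x `&` upset y,
    hence some U `&` V with U and V neighborhoods of x and y; by compactness of Q
    some neighborhoods U of x and V of Q satisfy U `&` V `<=` ~` C, so that x is
    not in closure (V `&` C). *)

Section Specialization.
Context {X : topologicalType}.
Implicit Types (x y : X) (A Q C U V W L : set X).

Lemma spec_le_refl x : spec_le x x.
Proof. by move=> U []. Qed.

Lemma spec_le_trans x y z : spec_le x y -> spec_le y z -> spec_le x z.
Proof. by move=> xy yz U Ux; apply: yz; split; [case: Ux|exact: xy]. Qed.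

Lemma sub_upset A : A `<=` upset A.
Proof. by move=> x Ax; exists x => //; exact: spec_le_refl. Qed.

Lemma saturated_upset A : saturated (upset A).
Proof. by move=> x y [z Az zx] xy; exists z => //; exact: spec_le_trans zx xy. Qed.

Lemma upset_sub_saturated A Q : saturated Q -> A `<=` Q -> upset A `<=` Q.
Proof. by move=> satQ AQ y [x /AQ Qx]; exact: satQ. Qed.

Lemma saturated_open U : open U -> saturated U.
Proof. by move=> oU x y Ux; apply. Qed.

Lemma upset_sub_open A U : open U -> (upset A `<=` U) = (A `<=` U).
Proof.
move=> oU; apply/propext; split; first by apply: subset_trans; exact: sub_upset.
by apply: upset_sub_saturated; exact: saturated_open.
Qed.

Lemma cover_compact_closedI Q C :
  cover_compact Q -> closed C -> cover_compact (Q `&` C).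
Proof.
move=> cQ cC I D f oD QCf.
pose g (o : option I) := if o is Some i then f i else ~` C.
have [| y Qy | F FD QF] :=
  cQ (option I) [set o | if o is Some i then D i else True] g.
- by case=> [i /oD|_] //; exact: closed_openC.
- have [Cy|nCy] := pselect (C y); last by exists None.
  by have [|i Di fiy] := QCf y; [|exists (Some i)].
(* [pmap id] drops [None] and strips [Some], leaving indices of the original cover. *)
exists [fset i in pmap id F]%fset.
  move=> i; rewrite !inE /= mem_pmap => /mapP[o /FD].
  by rewrite inE => Do oi; rewrite -oi in Do.
move=> y [/QF[[i|] /= iF gy] Cy]; last by case: (gy Cy).
by exists i => //=; rewrite !inE mem_pmap; apply/mapP; exists (Some i).
Qed.

(** Open sets are upward closed, so a finite subcover of [A] already covers [upset A]. *)
Lemma cover_compact_upset A : cover_compact A -> cover_compact (upset A).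
Proof.
move=> cA I D f oD Af.
have [|F FD AF] := cA I D f oD; first by apply: subset_trans Af; exact: sub_upset.
exists F => //; rewrite upset_sub_open//.
by apply: bigcup_open => i /FD/set_mem; exact: oD.
Qed.

Lemma is_lens_cover_compact L : is_lens L -> cover_compact L.
Proof. by case=> _ [Q [C [[cQ _] cC ->]]]; exact: cover_compact_closedI. Qed.

(** If [L] is the intersection of [Q] saturated and [C] closed, then [Q] contains [upset L] and [C]
    contains [closure L]. *)
Lemma is_lens_upsetIclosure L : is_lens L -> upset L `&` closure L = L.
Proof.
case=> _ [Q [C [[_ satQ] cC ->]]]; apply/seteqP; split=> [x [QCx clx]|x QCx].
  split; first by apply: (@upset_sub_saturated _ _ satQ _ _ QCx) => y [].
  by rewrite (iffLR (closure_id C) cC); apply: closureS clx => y [].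
by split; [exact: sub_upset|exact: subset_closure].
Qed.

Lemma closureI_open_neq0 A U : open U ->
  closure A `&` U !=set0 <-> A `&` U !=set0.
Proof.
move=> oU; split=> [[x [clx Ux]]|[x [Ax Ux]]].
  by apply: clx; exact: open_nbhs_nbhs.
by exists x; split=> //; exact: subset_closure.
Qed.

Lemma is_quasi_lens_of_lens L :
  is_lens L -> is_quasi_lens (upset L) (closure L).
Proof.
move=> lL; split.
- split; last exact: saturated_upset.
  exact/cover_compact_upset/is_lens_cover_compact.
- exact: closed_closure.
- by rewrite is_lens_upsetIclosure//; case: lL.
- by rewrite is_lens_upsetIclosure.
- move=> U oU; rewrite upset_sub_open// => LU.
  by apply: closureS => x Lx; split; [exact: LU|exact: subset_closure].
Qed.

End Specialization.

(** An induction principle for open sets: the left-hand family is what [open] unfolds to in the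
    topology generated by [S]. *)
Lemma open_subbase_sub (T : choiceType) (S O : set (set T)) :
  O [set: T] -> setI_closed O ->
  (forall F, F `<=` O -> O (\bigcup_(B in F) B)) -> S `<=` O ->
  [set \bigcup_(B in F) B | F in [set F | F `<=` finI_from S id]] `<=` O.
Proof.
move=> OT OI OU SO _ [F FS <-]; apply: OU => B /FS[E ES <-].
rewrite bigcap_fset /= big_seq.
by elim/big_ind: _ => // A /ES/set_mem; exact: SO.
Qed.

Section LensEmbedding.
Context {X : topologicalType}.
Implicit Types (L : lens X) (q : quasi_lens X) (U : set X).

Lemma open_lens_sub (O : set (set (lens X))) :
  O setT -> setI_closed O ->
  (forall F, F `<=` O -> O (\bigcup_(B in F) B)) ->
  (forall U, open U -> O (box U)) -> (forall U, open U -> O (diamond U)) ->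
  open `<=` O.
Proof.
move=> OT OI OU Ob Od; apply: open_subbase_sub OT OI OU _.
by move=> _ [] [U oU <-]; [exact: Ob|exact: Od].
Qed.

Lemma open_quasi_lens_sub (O : set (set (quasi_lens X))) :
  O setT -> setI_closed O ->
  (forall F, F `<=` O -> O (\bigcup_(B in F) B)) ->
  (forall U, open U -> O (qbox U)) -> (forall U, open U -> O (qdiamond U)) ->
  open `<=` O.
Proof.
move=> OT OI OU Ob Od; apply: open_subbase_sub OT OI OU _.
by move=> _ [] [U oU <-]; [exact: Ob|exact: Od].
Qed.

Lemma open_subbasic_lens (B : set (lens X)) :
  ([set box U | U in open] `|` [set diamond U | U in open]) B -> open B.
Proof.
move=> SB; exists [set B]; last by rewrite bigcup_set1.
by move=> _ ->; exact: finI_from1.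
Qed.

Lemma open_subbasic_quasi_lens (B : set (quasi_lens X)) :
  ([set qbox U | U in open] `|` [set qdiamond U | U in open]) B -> open B.
Proof.
move=> SB; exists [set B]; last by rewrite bigcup_set1.
by move=> _ ->; exact: finI_from1.
Qed.

Lemma lens_inj : injective (@lens_set X).
Proof.
case=> A lA [B lB] /= AB; case: _ / AB lB => lB.
by congr Lens; exact: Prop_irrelevance.
Qed.

Lemma quasi_lens_eq q1 q2 : ql_compact q1 = ql_compact q2 ->
  ql_closed q1 = ql_closed q2 -> q1 = q2.
Proof.
case: q1 q2 => [Q1 C1 p1] [Q2 C2 p2] /= QE CE.
case: _ / QE p2 => p2; case: _ / CE p2 => p2.
by congr QuasiLens; exact: Prop_irrelevance.
Qed.

Definition quasi_lens_of_lens L : quasi_lens X :=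
  QuasiLens (is_quasi_lens_of_lens _ (lensP L)).

Local Notation iota := quasi_lens_of_lens.

Lemma preimage_qbox U : open U -> iota @^-1` qbox U = box U.
Proof. by move=> oU; apply/seteqP; split=> L; rewrite /= /qbox /= upset_sub_open. Qed.

Lemma preimage_qdiamond U : open U -> iota @^-1` qdiamond U = diamond U.
Proof. by move=> oU; apply/seteqP; split=> L /(closureI_open_neq0 _ _ oU). Qed.

Lemma quasi_lens_of_lens_inj : injective iota.
Proof.
move=> L M /[dup] /(congr1 (@ql_compact X)) /= uE /(congr1 (@ql_closed X)) /= cE.
apply: lens_inj; rewrite -(is_lens_upsetIclosure _ (lensP L)).
by rewrite uE cE is_lens_upsetIclosure//; exact: lensP.
Qed.

Lemma quasi_lens_of_lens_continuous : continuous iota.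
Proof.
apply/continuousP; apply: open_quasi_lens_sub => [|A B|F FO|U oU|U oU].
- by rewrite preimage_setT; exact: openT.
- by rewrite preimage_setI; exact: openI.
- by rewrite preimage_bigcup; exact: bigcup_open.
- by rewrite preimage_qbox//; apply: open_subbasic_lens; left; exists U.
- by rewrite preimage_qdiamond//; apply: open_subbasic_lens; right; exists U.
Qed.

Lemma open_lens_preimage (A : set (lens X)) : open A ->
  exists2 V : set (quasi_lens X), open V & A = iota @^-1` V.
Proof.
move: A; apply: open_lens_sub => [|_ _ [V oV ->] [W oW ->]|F FO|U oU|U oU].
- by exists setT; [exact: openT|rewrite preimage_setT].
- by exists (V `&` W); [exact: openI|rewrite preimage_setI].
(* Taking every open [V] whose preimage lies in [F] avoids choosing one for each member. *)
- exists (\bigcup_(V in [set V | open V /\ F (iota @^-1` V)]) V).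
    by apply: bigcup_open => V [].
  rewrite preimage_bigcup; apply/seteqP; split=> L [B FB BL].
    by have [V oV BE] := FO _ FB; exists V; [split=> //|]; rewrite -BE.
  by exists (iota @^-1` B) => //; case: FB.
- exists (qbox U); last by rewrite preimage_qbox.
  by apply: open_subbasic_quasi_lens; left; exists U.
- exists (qdiamond U); last by rewrite preimage_qdiamond.
  by apply: open_subbasic_quasi_lens; right; exists U.
Qed.

Lemma quasi_lens_of_lens_embedding : embedding iota.
Proof.
split; [exact: quasi_lens_of_lens_inj|exact: quasi_lens_of_lens_continuous|].
move=> A /open_lens_preimage[V oV ->]; exists V => //.
apply/seteqP; split=> [_ [L VL <-]|_ [/[swap] -[L _ <-] VL]]; last by exists L.
by split=> //; exists L.
Qed.

Lemma is_lens_of_quasi_lens q : is_lens (ql_compact q `&` ql_closed q).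
Proof.
by case: q => Q C /= [cQ cC QC0 _ _]; split=> //; exists Q, C.
Qed.

Definition lens_of_quasi_lens q : lens X := Lens (is_lens_of_quasi_lens q).

Lemma quasi_lens_of_lensK : cancel iota lens_of_quasi_lens.
Proof. by move=> L; apply: lens_inj; exact/is_lens_upsetIclosure/lensP. Qed.

(** Saturation of [Q] and condition (2) give the first component; closedness of [C] and (P) applied
    to condition (3) give the second. *)
Lemma lens_of_quasi_lensK : propertyP X -> cancel lens_of_quasi_lens iota.
Proof.
move=> PX [Q C p]; have [cQ cC _ Qup CU] := p.
apply: quasi_lens_eq => /=; apply/seteqP; split=> //.
- by apply: upset_sub_saturated; [case: cQ|move=> x []].
- rewrite [X in _ `<=` X](iffLR (closure_id C) cC).
  by apply: closureS => x [].
- exact: PX.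
Qed.

Lemma lens_of_quasi_lens_continuous :
  propertyP X -> continuous lens_of_quasi_lens.
Proof.
move=> PX; apply/continuousP => _ /open_lens_preimage[V oV ->].
(* An open set of lenses is the preimage of some [V] under [iota], so its preimage under the inverse
   is [V] itself. *)
rewrite -comp_preimage (_ : _ \o _ = id)//.
by apply/funext => q; exact: lens_of_quasi_lensK.
Qed.

End LensEmbedding.

Lemma weakly_hausdorff_propertyP (X : topologicalType) :
  weakly_hausdorff X -> propertyP X.
Proof.
move=> wX Q C [cQ satQ] cC CU x Cx B; rewrite nbhsE => -[W [oW Wx] WB].
apply: contrapT => QCB0.
have WQC0 z : W z -> Q z -> ~ C z.
  by move=> Wz Qz Cz; apply: QCB0; exists z; split; [|exact: WB].
(* Quantifying over all [y] lets [choice] apply; outside [Q] the pair is a dummy. *)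
have sep y : exists UV : set X * set X, Q y ->
    [/\ open_nbhs x UV.1, open_nbhs y UV.2 & UV.1 `&` UV.2 `<=` ~` C].
  have [Qy|] := pselect (Q y); last by exists (set0, set0).
  have [||U [V UV]] := wX x y (~` C); [exact: closed_openC| |by exists (U, V)].
  (* A point above both [x] and [y] lies in the open set [W] and in the saturated set [Q], hence
     outside [C]. *)
  move=> z [[_ -> xz] [_ -> yz]]; apply: WQC0; last exact: satQ Qy yz.
  exact: xz.
have [UV UVP] := choice sep.
have [y /UVP[_ []]|y Qy|F FQ QF] // := cQ X Q (fun y => (UV y).2).
  by exists y => //; have [_ []] := UVP _ Qy.
pose V := \bigcup_(y in [set` F]) (UV y).2.
pose U := \bigcap_(y in [set` F]) (UV y).1.
have FQ' y : y \in F -> Q y by move=> /FQ/set_mem.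
have oV : open V by apply: bigcup_open => y /FQ'/UVP[_ []].
have nU : nbhs x U.
  rewrite /U bigcap_fset big_seq; elim/big_ind: _ => [|A D|y /FQ'/UVP[UVx _ _]].
  - exact: filterT.
  - exact: filterI.
  - exact: open_nbhs_nbhs.
(* As [V] is an open neighborhood of [Q], the neighborhood [U] of [x] meets [V]&[C]; the pair chosen
   for [y] forbids this. *)
have [z [[[y Fy Vz] Cz] Uz]] := CU V oV QF x Cx U nU.
by have [_ _ /(_ z)] := UVP y (FQ' y Fy); apply => //; split=> //; exact: Uz.
Qed.

Theorem theorem6p3 (X : topologicalType) :
  exists iota : lens X -> quasi_lens X,
    (forall L : lens X,
        ql_compact (iota L) = upset L /\ ql_closed (iota L) = closure L) /\
    embedding iota /\
    (forall U : set X, open U ->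
        iota @^-1` qbox U = box U /\ iota @^-1` qdiamond U = diamond U) /\
    (propertyP X ->
        exists rho : quasi_lens X -> lens X,
          (forall q : quasi_lens X,
              lens_set (rho q) = ql_compact q `&` ql_closed q) /\
          homeomorphism_with_inverse iota rho) /\
    (weakly_hausdorff X -> propertyP X).
Proof.
exists quasi_lens_of_lens; split; [by []|split; [|split; [|split]]].
- exact: quasi_lens_of_lens_embedding.
- by move=> U oU; rewrite preimage_qbox// preimage_qdiamond.
- move=> PX; exists lens_of_quasi_lens; split=> //; split.
  + exact: quasi_lens_of_lensK.
  + exact: lens_of_quasi_lensK.
  + exact: quasi_lens_of_lens_continuous.
  + exact: lens_of_quasi_lens_continuous.
- exact: weakly_hausdorff_propertyP.
Qed.
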